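(* Let $T$ be a tree of order $n$ with $\ell$ leaves. If $T$ is optimal in $\mathcal{T}_n$ (or if $T$ is optimal in $\mathcal{C}_n$), then $$\ell<2\lceil 2\log_2(n)\rceil+2.$$
   Context: The order of a graph is its number of vertices. A leaf is a vertex of degree at most $1$. A subtree of a tree $T$ is a nonempty connected subgraph. The mean subtree order $M_T$ is the average of the orders of all subtrees of $T$. A tree of maximum mean subtree order in a given family is called optimal in that family. $\mathcal{T}_n$ is the family of all trees of order $n$ and $\mathcal{C}_n$ is the family of all caterpillars of order $n$, where a caterpillar is a tree for which deleting all leaves leaves a path (possibly empty or a single vertex). *)

(* Defs.v *)
From HB Require Import structures.
From mathcomp Require Import all_boot all_order all_algebra.
From mathcomp Require Import reals exp.

Set Implicit Arguments.
Unset Strict Implicit.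
Unset Printing Implicit Defensive.

Import Order.TTheory GRing.Theory Num.Theory.

Local Open Scope ring_scope.

Record sgraph := SGraph {
  vertex :> finType;
  adj : rel vertex;
  adj_sym : symmetric adj;
  adj_irrefl : irreflexive adj }.

Section Graph.
Variable G : sgraph.

Definition degree (x : G) : nat := #|[set y | adj x y]|.

Definition leaves : {set G} := [set x | (degree x <= 1)%N].

Definition edges : {set {set G}} :=
  [set e | [exists x, exists y, adj x y && (e == [set x; y])]].

(** A subgraph [H] is given by its vertex set [H.1] and its edge set [H.2];
    it need not be induced. *)
Definition is_subgraph (H : {set G} * {set {set G}}) : bool :=
  (H.2 \subset edges) && [forall e in H.2, e \subset H.1].

(** For a subgraph, all edges lie inside [H.1], so walks starting in [H.1] stay
    there; the empty subgraph is excluded separately. *)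
Definition is_connected (H : {set G} * {set {set G}}) : bool :=
  [forall x in H.1, forall y in H.1,
     connect [rel u v | [set u; v] \in H.2] x y].

Definition whole_graph : {set G} * {set {set G}} := ([set: G], edges).

(** Closed walks of length 2 along a single edge are [ucycle]s of size 2, so the
    genuine cycles are the [ucycle]s of size at least 3. *)
Definition acyclic : Prop :=
  forall c : seq G, ucycle (@adj G) c -> (size c < 3)%N.

Definition is_tree : Prop :=
  [/\ (0 < #|G|)%N, is_connected whole_graph & acyclic].

Definition subtrees : {set {set G} * {set {set G}}} :=
  [set H | [&& is_subgraph H, H.1 != set0 & is_connected H]].

Definition mean_subtree_order : rat :=
  (\sum_(H in subtrees) #|H.1|)%N%:R / #|subtrees|%:R.

(** [G] is isomorphic to the path with [k] vertices; [k = 0] and [k = 1] are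
    allowed. *)
Definition is_path_graph : Prop :=
  exists k : nat, exists f : 'I_k -> G,
    bijective f /\
    forall i j : 'I_k, adj (f i) (f j) = (i.+1 == j) || (j.+1 == i).

End Graph.

Section Induced.
Variables (G : sgraph) (A : {set G}).

Definition induced_adj : rel {x : G | x \in A} :=
  [rel x y | adj (val x) (val y)].

Lemma induced_adj_sym : symmetric induced_adj.
Proof. by move=> x y; apply: adj_sym. Qed.

Lemma induced_adj_irrefl : irreflexive induced_adj.
Proof. by move=> x; apply: adj_irrefl. Qed.

Definition induced : sgraph := SGraph induced_adj_sym induced_adj_irrefl.

End Induced.

Definition is_caterpillar (G : sgraph) : Prop :=
  is_tree G /\ is_path_graph (induced (~: leaves G)).

Definition trees_of_order (n : nat) (G : sgraph) : Prop :=
  is_tree G /\ #|G| = n.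

Definition caterpillars_of_order (n : nat) (G : sgraph) : Prop :=
  is_caterpillar G /\ #|G| = n.

Definition optimal_in (F : sgraph -> Prop) (T : sgraph) : Prop :=
  F T /\
  forall T' : sgraph, F T' -> mean_subtree_order T' <= mean_subtree_order T.

Definition log2 (R : realType) (x : R) : R := ln x / ln 2.

(* Main.v *)
Require Import Defs.
From HB Require Import structures.
From mathcomp Require Import all_boot all_order all_algebra.
From mathcomp Require Import reals exp.
From mathcomp Require Import zify.

Set Implicit Arguments.
Unset Strict Implicit.
Unset Printing Implicit Defensive.

Import Order.TTheory GRing.Theory Num.Theory.

(** Two estimates of the mean subtree order of [T] are played against each
    other. Let [s] be the least integer with [2 log2 n <= s], so that
    [n ^ 2 <= 2 ^ s].

    Upper bound. A leaf [v] of a graph with at least three vertices belongs to at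
    most half of the subtrees: cutting [v] off embeds the subtrees containing [v]
    into those avoiding it. Summing over the leaves, the mean subtree order is at
    most [n - l / 2] ([sum_order_subtrees_leaves]).

    Lower bound. The baton is a path of [k = n - 2 s] vertices with [s] leaves
    attached at each end; it is a caterpillar, so [T] has to beat it in either
    family. Its [4 ^ s] subtrees that contain the whole path have mean order
    exactly [n - s], which exceeds [c = n - s - 1] by one. Every other subtree is
    an end segment of the path with some leaves of that end, or a segment of the
    vertex order; together these fall short of [c] by at most
    [2 ^ s * k (n - 1) + n ^ 2 * c], which is below [4 ^ s] because
    [n ^ 2 <= 2 ^ s]. So the mean subtree order of the baton is above [c]
    ([mean_baton_gt]).

    The comparison gives [n - s - 1 < n - l / 2], that is [l < 2 s + 2]. When
    [n <= 2 s + 1] the path would be too short to have two ends, but then [l <= n] suffices.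

    The subtrees of the baton are analysed through a parent function: a vertex of
    number [i > 0] is joined to a parent of smaller number. In such a graph a
    subtree is determined by its vertex set, and it contains the parents of all
    its vertices except the least one. *)

Local Open Scope nat_scope.

(** * A leaf lies in at most half of the subtrees *)

Section Subtrees.
Variable G : sgraph.
Implicit Types (H : {set G} * {set {set G}}) (e : {set G}) (x y v : G).

Lemma edgeP e :
  reflect (exists x y, adj x y /\ e = [set x; y]) (e \in edges G).
Proof.
rewrite inE; apply: (iffP existsP) => -[x]; last first.
  by case=> y [xy ->]; exists x; apply/existsP; exists y; rewrite xy eqxx.
by case/existsP=> y /andP[xy /eqP->]; exists x, y.
Qed.

Lemma mem_edge_set2 x y : ([set x; y] \in edges G) = adj x y.
Proof.
apply/edgeP/idP => [[a [b [ab]]]|xy]; last by exists x, y.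
move/setP=> E; move: (E x) (E y) (E a) (E b) ab; rewrite !inE !eqxx ?orbT.
rewrite !(eq_sym a) !(eq_sym b).
case: (x =P a) => [?|_]; case: (x =P b) => [?|_] //;
  case: (y =P a) => [?|_]; case: (y =P b) => [?|_] //; subst=> //= _ _ _ _.
all: by rewrite ?adj_irrefl // adj_sym.
Qed.

Definition edges_inside (V : {set G}) := [set e in edges G | e \subset V].

Definition step H : rel G := [rel x y | [set x; y] \in H.2].

Lemma subtreeP H :
  reflect [/\ H.2 \subset edges G, forall e, e \in H.2 -> e \subset H.1,
              H.1 != set0 & {in H.1 &, forall x y, connect (step H) x y}]
          (H \in subtrees G).
Proof.
rewrite inE; apply: (iffP and3P) => [[/andP[sE /forall_inP sV] H0 /forall_inP c]|].
  by split=> // x y xH yH; have /forall_inP := c x xH; apply.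
case=> sE sV H0 c; split=> //; first by rewrite /is_subgraph sE; apply/forall_inP.
by apply/forall_inP=> x xH; apply/forall_inP=> y yH; apply: c.
Qed.

Lemma step_sym H : symmetric (step H).
Proof. by move=> x y; rewrite /step /= setUC. Qed.

Lemma step_adj H x y : H \in subtrees G -> step H x y -> adj x y.
Proof. by case/subtreeP=> /subsetP sE _ _ _ /sE; rewrite mem_edge_set2. Qed.

Lemma step_memr H x y : H \in subtrees G -> step H x y -> y \in H.1.
Proof.
by case/subtreeP=> _ sV _ _ /sV /subsetP; apply; rewrite set22.
Qed.

Lemma single_vertex_subtree v : ([set v], set0) \in subtrees G.
Proof.
apply/subtreeP; split=> /=; first exact: sub0set.
- by move=> e; rewrite inE.
- by apply/set0Pn; exists v; rewrite set11.
by move=> x y /set1P-> /set1P->.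
Qed.

Lemma single_vertexE H v :
  H \in subtrees G -> H.1 = [set v] -> H = ([set v], set0).
Proof.
case: H => V E HT /= VE; rewrite VE in HT *; congr (_, _).
apply/setP=> e; rewrite inE; apply/negP => eE.
have /subtreeP[/subsetP sE sV _ _] := HT.
have /edgeP[x [y [xy exy]]] := sE _ eE.
move: xy; have /subsetP := sV _ eE; rewrite exy => s.
by rewrite (set1P (s x (set21 _ _))) (set1P (s y (set22 _ _))) adj_irrefl.
Qed.

(** [u] is the neighbour of the leaf [v] if there is one; for an isolated [v] any
    other vertex serves, so both cases are treated at once. *)
Section PruneLeaf.
Variables v u : G.
Hypothesis vu : u != v.
Hypothesis leaf_v : forall y, adj v y -> y = u.

Definition prune H := (H.1 :\ v, H.2 :\ [set v; u]).

(** A walk leaving [v] inside [H] can only start along the edge to [u]. *)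
Lemma leaf_edge_in H : H \in subtrees G -> v \in H.1 -> H.1 != [set v] ->
  [set v; u] \in H.2.
Proof.
move=> HT vH nv; have [y yH yv] : exists2 y, y \in H.1 & y != v.
  have /subsetPn[y yH] : ~~ (H.1 \subset [set v]).
    by apply: contra nv => s; rewrite eqEsubset s sub1set.
  by rewrite inE => yv; exists y.
have /subtreeP[_ _ _ /(_ v y vH yH)/connectP[[|z p] /=]] := HT.
  by move=> _ yE; rewrite yE eqxx in yv.
by case/andP=> vz _ _; rewrite -(leaf_v (step_adj HT vz)).
Qed.

(** Sending [v] to [u] and fixing all other vertices maps walks of [H] to walks
    of the pruned graph, which is therefore still connected. *)
Lemma prune_subtree H : H \in subtrees G -> v \in H.1 -> H.1 != [set v] ->
  prune H \in subtrees G.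
Proof.
move=> HT vH nv; have vuH := leaf_edge_in HT vH nv.
have uH : u \in H.1 by apply: (step_memr HT vuH).
have /subtreeP[sE sV H0 cH] := HT.
pose r x := if x == v then u else x.
have step_r x y : step H x y -> connect (step (prune H)) (r x) (r y).
  move=> xy; have := step_adj HT xy; rewrite /r.
  have [->|xv] := eqVneq x v; first by move/leaf_v->; rewrite (negPf vu).
  have [->|yv] := eqVneq y v; first by rewrite adj_sym => /leaf_v->.
  move=> _; apply: connect1; rewrite /step /= !inE; apply/andP; split=> //.
  apply: contraTneq (set21 v u) => <-.
  by rewrite !inE negb_or ![v == _]eq_sym xv yv.
have path_r x p : path (step H) x p ->
    connect (step (prune H)) (r x) (r (last x p)).
  elim: p x => [|y p IH] x //= /andP[/step_r xy /IH]; exact: connect_trans.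
apply/subtreeP; split=> /=.
- by apply: subset_trans sE; apply: subD1set.
- move=> e /setD1P[evu eH]; apply/subsetP=> x xe; rewrite !inE.
  rewrite (subsetP (sV _ eH) _ xe) andbT; apply: contraNneq evu => xv.
  have /edgeP[a [b [ab eab]]] := subsetP sE _ eH.
  move: xe; rewrite xv eab => /set2P[] vE; rewrite -vE in ab *.
    by rewrite (leaf_v ab).
  by rewrite adj_sym in ab; rewrite (leaf_v ab) setUC.
- by apply/set0Pn; exists u; rewrite !inE vu.
move=> x y /setD1P[xv xH] /setD1P[yv yH].
have /connectP[p /path_r] := cH x y xH yH.
by rewrite /r (negPf xv) => c yE; move: c; rewrite -yE (negPf yv).
Qed.

Lemma prune_inj H K :
  H \in subtrees G -> v \in H.1 -> H.1 != [set v] ->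
  K \in subtrees G -> v \in K.1 -> K.1 != [set v] ->
  prune H = prune K -> H = K.
Proof.
move=> HT vH nH KT vK nK [E1 E2].
rewrite [H]surjective_pairing [K]surjective_pairing.
rewrite -(setD1K vH) -(setD1K vK) E1.
by rewrite -(setD1K (leaf_edge_in HT vH nH)) -(setD1K (leaf_edge_in KT vK nK)) E2.
Qed.

(** Pruning settles all subtrees except [{v}] itself, and its values all contain
    [u]; so [{w}] is free to be the image of [{v}]. *)
Lemma prune_bound w : w != v -> w != u ->
  #|[set H in subtrees G | v \in H.1]| <= #|[set H in subtrees G | v \notin H.1]|.
Proof.
move=> wv wu; pose f H := if H.1 == [set v] then ([set w], set0) else prune H.
have fu H : H \in subtrees G -> v \in H.1 -> H.1 != [set v] -> u \in (prune H).1.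
  move=> HT vH nH; rewrite !inE vu.
  by apply: (step_memr HT (leaf_edge_in HT vH nH)).
have v_w : ([set v] == [set w]) = false.
  by rewrite (inj_eq set1_inj) eq_sym (negPf wv).
rewrite -(card_in_imset (f := f)); last first.
  move=> H K /setIdP[HT vH] /setIdP[KT vK]; rewrite /f.
  have [H1|nH] := eqVneq H.1 _; have [K1|nK] := eqVneq K.1 _.
  - by rewrite (single_vertexE HT H1) (single_vertexE KT K1).
  - move/(congr1 fst) => /= E; have := fu K KT vK nK.
    by rewrite /= -E inE eq_sym (negPf wu).
  - move/(congr1 fst) => /= E; have := fu H HT vH nH.
    by rewrite /= E inE eq_sym (negPf wu).
  - exact: prune_inj.
apply/subset_leq_card/subsetP => K /imsetP[H /setIdP[HT vH] ->].
rewrite inE /f; have [H1|nH] := eqVneq H.1 _.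
  by rewrite single_vertex_subtree inE eq_sym.
by rewrite prune_subtree //= !inE eqxx.
Qed.

End PruneLeaf.

Lemma leaf_in_half_of_subtrees v : 3 <= #|G| -> v \in leaves G ->
  #|[set H in subtrees G | v \in H.1]| <= #|[set H in subtrees G | v \notin H.1]|.
Proof.
move=> G3; rewrite inE => dv.
have other x : exists w, (w != v) && (w != x).
  have /set0Pn[w] : ~: [set v; x] != set0.
    rewrite -card_gt0 cardsCs setCK cards2; move: G3; case: (v != x) => /=; lia.
  by rewrite !inE negb_or => wP; exists w.
have [u /andP[uv leaf_u]] : exists u, (u != v) && [forall y, adj v y ==> (y == u)].
  have [/eqP d0|[u vu]] := set_0Vmem [set y | adj v y].
    have [u /andP[uv _]] := other v; exists u; rewrite uv; apply/forallP=> y.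
    by move/eqP/setP/(_ y): d0; rewrite !inE => ->.
  exists u; move: vu; rewrite inE => vu; apply/andP; split.
    by apply: contraTneq vu => ->; rewrite adj_irrefl.
  apply/forallP=> y; apply/implyP=> vy.
  by apply/eqP/(card_le1_eqP dv); rewrite inE.
have [w /andP[wv wu]] := other u.
apply: (prune_bound uv _ wv wu) => y vy.
by apply/eqP/(implyP (forallP leaf_u y)).
Qed.

(** Double counting of incidences between vertices and subtrees: a leaf meets at
    most half of the subtrees, any other vertex at most all of them. *)
Lemma sum_order_subtrees_leaves : 3 <= #|G| ->
  2 * (\sum_(H in subtrees G) #|H.1|) + #|leaves G| * #|subtrees G|
    <= 2 * #|G| * #|subtrees G|.
Proof.
move=> G3.
have -> : \sum_(H in subtrees G) #|H.1|
        = \sum_(x : G) #|[set H in subtrees G | x \in H.1]|.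
  under eq_bigr do rewrite -sum1_card big_mkcond.
  rewrite exchange_big; apply: eq_bigr => x _.
  rewrite -big_mkcondr sum1dep_card; apply: eq_card => H.
  by rewrite !inE.
rewrite -(sum1_card (mem (leaves G))) (big_mkcond (mem (leaves G))) /=.
rewrite big_distrr big_distrl -big_split /=.
rewrite mulnAC mulnC -sum_nat_const; apply: leq_sum => x _.
pose A := [set H : {set G} * {set {set G}} | x \in H.1].
have := cardsID A (subtrees G).
have -> : subtrees G :&: A = [set H in subtrees G | x \in H.1].
  by apply/setP=> H; rewrite !inE.
have -> : subtrees G :\: A = [set H in subtrees G | x \notin H.1].
  by apply/setP=> H; rewrite !inE andbC.
have halved a b N : a <= b -> a + b = N -> 2 * a + 1 * N <= 2 * N by lia.
have bounded a b N : a + b = N -> 2 * a + 0 * N <= 2 * N by lia.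
by case: ifP => [/(leaf_in_half_of_subtrees G3)|_]; [apply: halved | apply: bounded].
Qed.

End Subtrees.

(** * Graphs defined by a parent function *)

Section ParentTree.
Variables (n : nat) (p : nat -> nat).
(* The predecessor makes [0] its own parent and every other parent smaller. *)
Hypothesis p_le : forall i, p i <= i.-1.

Definition parent_adj : rel 'I_n :=
  [rel x y : 'I_n | (0 < x) && (p x == y) || (0 < y) && (p y == x)].

Lemma parent_adj_sym : symmetric parent_adj.
Proof. by move=> x y; rewrite /parent_adj /= orbC. Qed.

Lemma parent_adj_irrefl : irreflexive parent_adj.
Proof. by move=> x; rewrite /parent_adj /=; have := p_le x; case: eqP; lia. Qed.

Definition parent_graph : sgraph := SGraph parent_adj_sym parent_adj_irrefl.

Lemma parent_adjP (x y : parent_graph) : x < y -> adj x y = (p y == x).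
Proof. by move=> xy; rewrite /adj /= /parent_adj /=; have := p_le x; lia. Qed.

(** If the edge from [v] to its parent is missing, walks of [H] from [v] stay
    among the descendants of [v], whose numbers are at least [v]; so [m < v] could
    not be reached. *)
Lemma subtree_parent_edge H (m v q : parent_graph) : H \in subtrees parent_graph ->
  m \in H.1 -> v \in H.1 -> m < v -> q = p v :> nat -> [set v; q] \in H.2.
Proof.
move=> HT mH vH mv qE; apply/negPn/negP => nvq.
pose below (x : parent_graph) := exists j, iter j p x = v.
have below_step x y : step H x y -> below x -> below y.
  move=> xy [j]; case/orP: (step_adj HT xy) => /andP[_ /eqP E].
    case: j => [/= /val_inj xv|j]; last by rewrite iterSr E; exists j.
    move: xy; rewrite /step /= xv; suff -> : y = q by rewrite (negPf nvq).
    by apply: val_inj; rewrite /= qE -xv.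
  by exists j.+1; rewrite iterSr E.
have below_path s x : path (step H) x s -> below x -> below (last x s).
  elim: s x => [|y s IH] x //= /andP[xy /IH ih] /(below_step _ _ xy); exact: ih.
have iter_le j i : iter j p i <= i.
  by elim: j => //= j ih; have := p_le (iter j p i); lia.
have /subtreeP[_ _ _ /(_ v m vH mH)/connectP[s /below_path vs mE]] := HT.
have [|j jv] := vs; first by exists 0.
by have := iter_le j m; rewrite mE jv -mE; lia.
Qed.

(** The larger end of an edge inside [H.1] is the child, and the smaller one
    witnesses that the child is not the least vertex. *)
Lemma subtree_edges H : H \in subtrees parent_graph ->
  H.2 = edges_inside H.1.
Proof.
move=> HT; have /subtreeP[/subsetP sE sV _ _] := HT.
apply/setP => e; apply/idP/setIdP => [eH|]; first by rewrite sE ?sV.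
case=> /edgeP[x [y [xy ->]]]; rewrite subUset !sub1set => /andP[].
wlog lt_yx : x y xy / y < x.
  move=> W xH yH; have [yx|xLy|/val_inj E] := ltngtP y x.
  - exact: W.
  - by rewrite setUC; apply: W => //; rewrite adj_sym.
  - by move: xy; rewrite E adj_irrefl.
rewrite adj_sym parent_adjP // in xy.
move=> xH yH; apply: (subtree_parent_edge HT yH xH) => //.
by apply/esym/eqP.
Qed.

Lemma subtree_vertices_inj :
  {in subtrees parent_graph &, injective (fun H => H.1)}.
Proof.
move=> [V E] [V' E'] HT KT /= VV'; move: (subtree_edges HT) (subtree_edges KT).
by rewrite /= VV' => -> ->.
Qed.

(** Following parents leads from any vertex of [V] to [r] inside [V]. *)
Lemma parent_closed_subtree (r : parent_graph) (V : {set parent_graph}) : r \in V ->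
  (forall v, v \in V -> v != r -> 0 < v /\ exists2 q, q \in V & p v = q :> nat) ->
  (V, edges_inside V) \in subtrees parent_graph.
Proof.
move=> rV V_closed; apply/subtreeP; split=> /=.
- by apply/subsetP=> e /setIdP[].
- by move=> e /setIdP[].
- by apply/set0Pn; exists r.
set H := (V, _).
have to_root m (v : parent_graph) : v <= m -> v \in V -> connect (step H) v r.
  elim: m v => [|m IH] v vm vV; have [->|vr] := eqVneq v r; rewrite ?connect0 //.
    by have [v0] := V_closed v vV vr; lia.
  have [v0 [q qV qE]] := V_closed v vV vr.
  apply: (@connect_trans _ _ q); last by apply: IH; have := p_le v; lia.
  apply: connect1; apply/setIdP; rewrite mem_edge_set2 subUset !sub1set vV qV.
  by split=> //; rewrite adj_sym parent_adjP; [rewrite qE eqxx | have := p_le v; lia].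
move=> x y xV yV; apply: (@connect_trans _ _ r); first exact: (to_root x).
by rewrite (sym_connect_sym (@step_sym _ H)) (to_root y).
Qed.

(** The two neighbours on a cycle of its largest vertex are both smaller, hence
    both equal to its parent. *)
Lemma parent_graph_acyclic : acyclic parent_graph.
Proof.
move=> c /andP[cyc uc]; rewrite ltnNge; apply/negP => c3.
have [x xc xmax] : exists2 x, x \in c & forall y, y \in c -> y <= x.
  case: c {cyc uc} c3 => [//|x0 c _].
  have := @arg_maxnP _ x0 (mem (x0 :: c)) val (mem_head _ _).
  by case=> x xc xmax; exists x => // y /xmax.
have [i c' cE] := rot_to xc.
move: cyc uc c3 xmax; rewrite -(rot_cycle i) -(rot_uniq i) -(size_rot i c).
move=> cyc uc c3 xmax; have {xmax} xmax y : y \in x :: c' -> y <= x.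
  by rewrite -cE mem_rot; apply: xmax.
move: cyc uc c3; rewrite cE; case/lastP: c' xmax {cE} => [//|[//|y c''] z] xmax.
rewrite (cycle_path x) /= !last_rcons !rcons_path.
move=> /and3P[zx xy _] /and3P[xn yn _] _.
have px w : w != x -> w \in [:: x, y & rcons c'' z] -> adj w x -> p x = w.
  move=> wx /xmax wLx; rewrite parent_adjP; first by move/eqP.
  by rewrite ltn_neqAle wLx andbT.
suff yz : y = z by rewrite yz mem_rcons mem_head in yn.
move: xn; rewrite !inE mem_rcons inE !negb_or => /and3P[nxy nxz _].
apply: val_inj; rewrite /= -(px y) ?(px z) ?(eq_sym _ x) //.
- by rewrite !inE mem_rcons mem_head !orbT.
- by rewrite !inE eqxx orbT.
- by rewrite adj_sym.
Qed.

Lemma parent_graph_tree : 0 < n -> is_tree parent_graph.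
Proof.
move=> n0; split; [by rewrite card_ord | | exact: parent_graph_acyclic].
have TT : ([set: parent_graph], edges_inside [set: parent_graph])
    \in subtrees parent_graph.
  apply: (@parent_closed_subtree (Ordinal n0)) => [|v _ v0]; first by rewrite inE.
  split; first by rewrite lt0n.
  by exists (Ordinal (leq_ltn_trans (leq_trans (p_le v) (leq_pred v)) (ltn_ord v))).
move: TT; rewrite inE => /and3P[_ _].
suff -> : edges_inside [set: parent_graph] = edges parent_graph by [].
by apply/setP=> e; rewrite /edges_inside inE subsetT andbT.
Qed.

End ParentTree.

(** * Sums over finite sets *)

Lemma card_ord_itv n a b : b <= n -> #|[set x : 'I_n | a <= x < b]| = b - a.
Proof.
move=> bn; rewrite -sum1dep_card -(big_mkord (fun i => a <= i < b) (fun=> 1)).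
rewrite -(big_nat_widen _ _ _ (leq a) _ bn) big_mkord.
have /= <- := @big_geq_mkord _ 0 addn a b predT (fun=> 1).
by rewrite sum_nat_const_nat muln1.
Qed.

(** Complementation in [D] pairs subsets whose sizes add up to [#|D|]. *)
Lemma sum_card_powerset (T : finType) (D : {set T}) :
  2 * \sum_(A in powerset D) #|A| = #|D| * 2 ^ #|D|.
Proof.
have DD A : A \in powerset D -> D :\: (D :\: A) = A.
  by rewrite inE => AD; rewrite setDDr setDv set0U; apply/setIidPr.
have E : \sum_(A in powerset D) #|A| = \sum_(A in powerset D) #|D :\: A|.
  rewrite (reindex_onto (setD D) (setD D)) //=; apply: eq_bigl => A.
  rewrite inE subsetDl /=; apply/eqP/idP => [<-|/DD //].
  by rewrite inE subsetDl.
rewrite mul2n -addnn {2}E -big_split /= -card_powerset mulnC -sum_nat_const.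
apply: eq_bigr => A; rewrite inE => /setIidPr AD.
by rewrite -(cardsID A D) AD.
Qed.

(** Bounds a sum over a parametrised family: members reached from several indices
    are counted repeatedly on the right, which only increases it. *)
Lemma leq_sum_imset (I T : finType) (D : {set I}) (f : I -> T) (g : T -> nat) :
  \sum_(t in f @: D) g t <= \sum_(i in D) g (f i).
Proof.
rewrite (partition_big_imset f) /=; apply: leq_sum => t /imsetP[i iD ->].
by rewrite (bigD1 i) ?iD ?eqxx //= leq_addr.
Qed.

Lemma leq_sum_cover3 (T : finType) (W A B C : {set T}) (g : T -> nat) :
  W \subset A :|: B :|: C ->
  \sum_(t in W) g t
    <= \sum_(t in A) g t + \sum_(t in B) g t + \sum_(t in C) g t.
Proof.
move/subsetP=> WABC; rewrite ![\sum_(_ in _) _]big_mkcond -!big_split /=.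
apply: leq_sum => t _; case: ifP => // /WABC; rewrite !inE.
by do 3! [case: (t \in _)] => //=; lia.
Qed.

(** * Subtrees of the baton *)

Section Baton.
Variables k s : nat.

(** Vertices below [k] form the path; the next [s] are leaves attached to vertex
    [0] and the last [s] are leaves attached to vertex [k.-1]. *)
Definition baton_parent i :=
  if i < k then i.-1 else if i < k + s then 0 else k.-1.

Lemma baton_parent_le i : baton_parent i <= i.-1.
Proof. by rewrite /baton_parent; case: ifP => //; case: ifP; lia. Qed.

Definition baton : sgraph := @parent_graph (k + s + s) _ baton_parent_le.

Hypotheses (k_gt1 : 1 < k) (s_gt0 : 0 < s).

Lemma baton_leaves : leaves baton = [set x : baton | k <= x].
Proof.
apply/setP=> x; rewrite !inE; apply/idP/idP=> [|kx]; last first.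
  have nx : baton_parent x < k + s + s.
    by have := baton_parent_le x; have := ltn_ord x; lia.
  have sub : [set y | adj x y] \subset [set (Ordinal nx : baton)].
    apply/subsetP=> y; rewrite !inE -val_eqE /adj /= /parent_adj /=.
    rewrite [baton_parent y]/baton_parent; case: ifP; last case: ifP; lia.
  by have := subset_leq_card sub; rewrite cards1.
apply: contraTT; rewrite -!ltnNge => xk.
(* Two neighbours of a path vertex: the preceding one and the following one,
   replaced at an end of the path by the first leaf attached there. *)
have an : (if x == 0 :> nat then k else x.-1) < k + s + s by case: ifP; lia.
have bn : (if x == k.-1 :> nat then k + s else x.+1) < k + s + s by case: ifP; lia.
have sub : [set (Ordinal an : baton); Ordinal bn] \subset [set y | adj x y].
  rewrite subUset !sub1set !inE /adj /= /parent_adj /= /baton_parent.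
  by do ![case: ifP] => /=; lia.
apply: leq_trans (subset_leq_card sub); rewrite cards2 -val_eqE /=.
by do ![case: ifP] => /=; lia.
Qed.

Lemma baton_tree : is_tree baton.
Proof. by apply: parent_graph_tree; lia. Qed.

Lemma baton_caterpillar : is_caterpillar baton.
Proof.
split; first exact: baton_tree.
have core_lt (i : 'I_k) : i < k + s + s by have := ltn_ord i; lia.
have in_core (x : baton) : (x \in ~: leaves baton) = (x < k).
  by rewrite baton_leaves !inE -ltnNge.
have core_in (i : 'I_k) : (Ordinal (core_lt i) : baton) \in ~: leaves baton.
  by rewrite in_core /= ltn_ord.
pose f i : induced (~: leaves baton) := Sub (Ordinal (core_lt i) : baton) (core_in i).
have lt_core (x : induced (~: leaves baton)) : val (val x) < k.
  by rewrite -in_core; apply: valP.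
exists k, f; split.
  exists (fun x => Ordinal (lt_core x)) => [i|x]; first exact: val_inj.
  by do 2 apply: val_inj.
move=> i j; have := ltn_ord i; have := ltn_ord j.
rewrite /adj /= /induced_adj /= /adj /= /parent_adj /= /baton_parent => -> ->.
by lia.
Qed.

Definition left_leaves : {set baton} := [set x : baton | k <= x < k + s].
Definition right_leaves : {set baton} := [set x : baton | k + s <= x < k + s + s].
Definition core_below (j : nat) : {set baton} := [set x : baton | x < j].
Definition core := core_below k.
Definition core_above (j : nat) : {set baton} := [set x : baton | j.+1 <= x < k].
Definition interval (a b : nat) : {set baton} := [set x : baton | a <= x <= b].

Definition spanning_sets := [set core :|: A | A in powerset (leaves baton)].
Definition left_sets :=
  [set core_below x.1 :|: x.2
    | x : 'I_k * {set baton} in setX [set: 'I_k] (powerset left_leaves)].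
Definition right_sets :=
  [set core_above x.1 :|: x.2
    | x : 'I_k * {set baton} in setX [set: 'I_k] (powerset right_leaves)].
Definition interval_sets :=
  [set interval x.1 x.2 | x : baton * baton in setT].

Lemma subtree_parent H (m v : baton) : H \in subtrees baton ->
  m \in H.1 -> v \in H.1 -> m < v ->
  exists2 q, q \in H.1 & q = baton_parent v :> nat.
Proof.
move=> HT mH vH mv; have lt_v : baton_parent v < k + s + s.
  by have := baton_parent_le v; have := ltn_ord v; lia.
exists (Ordinal lt_v) => //.
by apply: (step_memr HT (subtree_parent_edge HT mH vH mv _)).
Qed.

Lemma spanning_subtree (A : {set baton}) :
  (core :|: A, edges_inside (core :|: A)) \in subtrees baton.
Proof.
have lt0 : 0 < k + s + s by lia.
apply: (@parent_closed_subtree _ _ baton_parent_le (Ordinal lt0)).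
  by rewrite !inE /=; lia.
move=> v _ v0; split; first by rewrite lt0n.
have lt_v : baton_parent v < k + s + s.
  by have := baton_parent_le v; have := ltn_ord v; lia.
exists (Ordinal lt_v) => //; rewrite !inE /= /baton_parent.
by apply/orP; left; do ![case: ifP]; lia.
Qed.

(** The four cases are decided by which of the two ends of the path belong to
    [H]. A leaf other than the least vertex of [H] brings in its parent, and
    a path vertex of [H] brings in all path vertices down to the least vertex. *)
Lemma subtree_vertices_cases H : H \in subtrees baton ->
  [\/ H.1 \in spanning_sets, H.1 \in left_sets, H.1 \in right_sets
    | H.1 \in interval_sets].
Proof.
move=> HT; set S := H.1.
have par (m v : baton) : m \in S -> v \in S -> m < v ->
    exists2 q, q \in S & q = baton_parent v :> nat := subtree_parent HT.
have lt0 : 0 < k + s + s by lia.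
have ltk : k.-1 < k + s + s by lia.
pose c0 : baton := Ordinal lt0; pose ck : baton := Ordinal ltk.
have S0 : exists x, x \in S by apply/set0Pn; case/subtreeP: HT.
have [m mS mmin] : exists2 m : baton, m \in S & forall x : baton, x \in S -> m <= x.
  case: S0 => x0 x0S; have := @arg_minnP baton x0 (mem S) val x0S.
  by case=> y yS ymin; exists y => // x /ymin.
have [m' m'S mmax] : exists2 m' : baton, m' \in S & forall x : baton, x \in S -> x <= m'.
  case: S0 => x0 x0S; have := @arg_maxnP baton x0 (mem S) val x0S.
  by case=> y yS ymax; exists y => // x /ymax.
have core_convex (v x : baton) : v \in S -> v < k -> m <= x <= v -> x \in S.
  have [d] := ubnP (v - x); elim: d v => // d IH v vx_d vS vk /andP[mx xv].
  have [xv_eq|x_neq_v] := eqVneq x v; first by rewrite xv_eq.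
  have x_lt_v : x < v by rewrite ltn_neqAle xv andbT.
  have [q qS] := par m v mS vS (leq_ltn_trans mx x_lt_v).
  by rewrite /baton_parent vk => qE; apply: (IH q) => //; lia.
have left_c0 (v : baton) : v \in S -> m < v -> k <= v < k + s -> c0 \in S.
  move=> vS mv /andP[kv vks]; have [q qS qE] := par m v mS vS mv.
  suff <- : q = c0 by []; apply: val_inj; rewrite /= qE /baton_parent ltnNge kv.
  by rewrite /= vks.
have right_ck (v : baton) : v \in S -> m < v -> k + s <= v -> ck \in S.
  move=> vS mv ksv; have [q qS qE] := par m v mS vS mv.
  suff <- : q = ck by []; apply: val_inj; rewrite /= qE /baton_parent.
  by do ![case: ifP]; lia.
have [c0S|c0S] := boolP (c0 \in S); have [ckS|ckS] := boolP (ck \in S).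
- apply: Or41; apply/imsetP; exists (S :&: leaves baton).
    by rewrite inE subsetIr.
  apply/setP=> x; rewrite baton_leaves !inE; have [xk|xk] := ltnP x k; last by rewrite andbT.
  by apply: (core_convex ck) => //=; have := mmin _ c0S => /=; lia.
(* [j] is the first vertex of the path that [H] misses. *)
- apply: Or42.
  have [j jS jmin] : exists2 j : baton, j \notin S & forall x : baton, x \notin S -> j <= x.
    have := @arg_minnP baton ck (predC (mem S)) val ckS.
    by case=> y yS ymin; exists y => // x /ymin.
  have jk : j < k by have := jmin _ ckS => /=; lia.
  have m0 : m = 0 :> nat by have := mmin _ c0S => /=; lia.
  apply/imsetP; exists (Ordinal jk, S :&: left_leaves) => /=.
    by rewrite !inE subsetIr.
  apply/setP=> x; rewrite !inE /=; have [xj|jx] := ltnP x j.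
    by apply/negPn/negP => /jmin; lia.
  apply/idP/andP => [xS|[] //]; split=> //; apply/andP; split.
    by rewrite leqNgt; apply: contra jS => xk; apply: (core_convex x) => //; lia.
  by rewrite ltnNge; apply: contra ckS => ksx; apply: (right_ck x) => //; lia.
(* Every left leaf in [H] would force vertex [0]; so [H] starts on the path. *)
- apply: Or43.
  have m_gt0 : 0 < m.
    rewrite lt0n; apply: contra c0S => /eqP m0.
    by rewrite (_ : c0 = m) //; apply: val_inj.
  have mk : m < k by have := mmin _ ckS => /=; lia.
  have m1k : m.-1 < k by lia.
  apply/imsetP; exists (Ordinal m1k, S :&: right_leaves) => /=.
    by rewrite !inE subsetIr.
  apply/setP=> x; rewrite !inE /= ltn_ord andbT prednK //.
  have [xk|kx] := ltnP x k.
    rewrite andbT (_ : k + s <= x = false) ?andbF ?orbF; last by lia.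
    apply/idP/idP => [/mmin //|mx]; apply: (core_convex ck) => //=; lia.
  rewrite andbF; apply/idP/andP => [xS|[] //]; split=> //.
  by rewrite leqNgt; apply: contra c0S => xks; apply: (left_c0 x) => //; lia.
(* The segment between the least and greatest vertices lies on the path, or is a
   single leaf. *)
- apply: Or44; apply/imsetP; exists (m, m') => //; apply/setP=> x; rewrite !inE /=.
  apply/idP/idP => [xS|/andP[mx xm']]; first by rewrite mmin ?mmax.
  have [m'k|km'] := ltnP m' k; first by apply: (core_convex m') => //; lia.
  suff mm' : m = m' :> nat by rewrite (_ : x = m) //; apply: val_inj => /=; lia.
  have := mmin _ m'S; rewrite leq_eqVlt => /orP[/eqP //|lt_mm'].
  have [m'ks|ksm'] := ltnP m' (k + s).
    by move: c0S; rewrite (left_c0 m') ?km'.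
  by move: ckS; rewrite (right_ck m').
Qed.

Lemma card_leaves_baton : #|leaves baton| = s + s.
Proof.
rewrite baton_leaves -[RHS](addKn k) addnA -(card_ord_itv k (leqnn _)).
by apply: eq_card => x; rewrite !inE ltn_ord andbT.
Qed.

Lemma card_core_leaves A : A \in powerset (leaves baton) ->
  #|core :|: A| = k + #|A|.
Proof.
rewrite inE baton_leaves => /subsetP Aleaf; rewrite cardsU.
rewrite (_ : core :&: A = set0) ?cards0 ?subn0.
  by rewrite (@card_ord_itv _ 0) ?subn0 // -addnA leq_addr.
by apply/setP=> x; rewrite !inE; apply/negP => /andP[xk /Aleaf]; rewrite inE; lia.
Qed.

Lemma core_setU_inj :
  {in powerset (leaves baton) &, injective (setU core)}.
Proof.
have trace A : A \in powerset (leaves baton) -> (core :|: A) :&: leaves baton = A.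
  rewrite inE => /setIidPl AE; rewrite setIUl AE.
  suff -> : core :&: leaves baton = set0 by rewrite set0U.
  by rewrite baton_leaves; apply/setP=> x; rewrite !inE; lia.
by move=> A B /trace {2}<- /trace {2}<- ->.
Qed.

Lemma card_spanning_sets : #|spanning_sets| = 2 ^ (s + s).
Proof.
rewrite card_in_imset ?card_powerset ?card_leaves_baton //.
exact: core_setU_inj.
Qed.

Lemma sum_spanning_sets : \sum_(S in spanning_sets) #|S| = (k + s) * 2 ^ (s + s).
Proof.
rewrite big_imset /=; last exact: core_setU_inj.
rewrite (eq_bigr _ card_core_leaves) big_split sum_nat_const card_powerset /=.
have average a N : 2 * a = (s + s) * N -> N * k + a = (k + s) * N by lia.
by rewrite card_leaves_baton; apply: average; rewrite sum_card_powerset card_leaves_baton.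
Qed.

(** The leaves in an end set are ignored: the deficit is bounded by that of its
    path segment, for each of the [2 ^ s] choices of leaves. *)
Lemma deficit_end_sets (D : {set baton}) (f : nat -> {set baton}) (a : 'I_k -> nat) c :
  #|D| = s -> (forall j : 'I_k, c - #|f j| <= a j) ->
  \sum_(S in [set f x.1 :|: x.2
               | x : 'I_k * {set baton} in setX [set: 'I_k] (powerset D)])
     (c - #|S|) <= 2 ^ s * \sum_(j < k) a j.
Proof.
move=> Ds fa; apply: leq_trans (leq_sum_imset _ _ _) _ => /=.
rewrite (eq_bigl (fun x => (x.1 \in [set: 'I_k]) && (x.2 \in powerset D))); last first.
  by case=> j A; rewrite in_setX.
rewrite -(pair_big (mem [set: 'I_k]) (mem (powerset D)) (fun i A => c - #|f i :|: A|)) /=.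
rewrite big_distrr /= big_mkcond; apply: leq_sum => j _; rewrite inE.
have <- : #|powerset D| = 2 ^ s by rewrite card_powerset Ds.
rewrite -sum_nat_const; apply: leq_sum => A _.
apply: leq_trans (fa j); apply/leq_sub2l/subset_leq_card/subsetUl.
Qed.

(** The spanning subtrees exceed the order [c = k + s - 1] by [1] on average, a
    total of [2 ^ (s + s)]; it remains to see that the truncated deficits
    [c - #|S|] of all other subtrees add up to less. *)
Lemma mean_baton_gt : (k + s + s) ^ 2 <= 2 ^ s ->
  (k + s - 1) * #|subtrees baton| < \sum_(H in subtrees baton) #|H.1|.
Proof.
set n := k + s + s; set c := k + s - 1 => n2.
pose V := [set H.1 | H in subtrees baton].
have inj := @subtree_vertices_inj _ _ baton_parent_le.
have -> : #|subtrees baton| = #|V| by apply/esym/card_in_imset/inj.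
have -> : \sum_(H in subtrees baton) #|H.1| = \sum_(S in V) #|S|.
  by rewrite big_imset //; apply: inj.
have spanV : spanning_sets \subset V.
  apply/subsetP=> S /imsetP[A _ ->].
  by apply/imsetP; eexists; first exact: spanning_subtree.
have deficit : \sum_(S in V :\: spanning_sets) (c - #|S|) < 2 ^ (s + s).
  have cover : V :\: spanning_sets \subset left_sets :|: right_sets :|: interval_sets.
    apply/subsetP=> S /setDP[/imsetP[H /subtree_vertices_cases HV ->] nS].
    by case: HV nS => [->|HV|HV|HV] // _; rewrite !inE HV ?orbT.
  apply: leq_ltn_trans (leq_sum_cover3 _ cover) _.
  have L : \sum_(S in left_sets) (c - #|S|) <= 2 ^ s * \sum_(j < k) (c - j).
    apply: deficit_end_sets.
      by rewrite card_ord_itv ?addKn // leq_addr.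
    move=> j; rewrite (@card_ord_itv _ 0) ?subn0 //; have := ltn_ord j; lia.
  have R : \sum_(S in right_sets) (c - #|S|) <= 2 ^ s * \sum_(j < k) (s + j).
    apply: deficit_end_sets; first by rewrite card_ord_itv ?addKn.
    by move=> j; rewrite card_ord_itv ?subn0 /c; have := ltn_ord j; lia.
  have I : \sum_(S in interval_sets) (c - #|S|) <= n ^ 2 * c.
    apply: leq_trans (leq_sum_imset _ _ _) _.
    rewrite -[n]card_ord -mulnn -card_prod -cardsT -sum_nat_const.
    by apply: leq_sum => x _; apply: leq_subr.
  (* The left deficit at [j] decreases with [j] and the right one increases, with
     constant sum [n - 1]; bounding each by its maximum would lose nearly a factor of 2. *)
  have LR : \sum_(j < k) (c - j) + \sum_(j < k) (s + j) = k * (n - 1).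
    rewrite -big_split (eq_bigr (fun=> n - 1)) /= ?sum_nat_const ?card_ord //.
    by move=> j _; rewrite /c /n; have := ltn_ord j; lia.
  apply: leq_ltn_trans (leq_add (leq_add L R) I) _.
  rewrite -mulnDr LR expnD.
  have c_lt_n : c < n by rewrite /c /n; lia.
  have kn : k * (n - 1) + c < n ^ 2.
    have -> : n ^ 2 = k * n + s * n + s * n by rewrite -!mulnDl mulnn.
    by rewrite mulnBr muln1; have := leq_pmull n s_gt0; lia.
  have [X0 kX] : 0 < 2 ^ s /\ k * (n - 1) + c < 2 ^ s.
    by rewrite expn_gt0; split=> //; apply: leq_trans n2.
  apply: leq_ltn_trans (_ : _ <= 2 ^ s * (k * (n - 1) + c)) _.
    by rewrite mulnDr leq_add2l leq_mul2r n2 orbT.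
  by rewrite ltn_mul2l X0.
have rest : c * #|V :\: spanning_sets| <= \sum_(S in V :\: spanning_sets) #|S|
    + \sum_(S in V :\: spanning_sets) (c - #|S|).
  by rewrite -big_split /= mulnC -sum_nat_const; apply: leq_sum => S _; lia.
have span : \sum_(S in spanning_sets) #|S| = c.+1 * 2 ^ (s + s).
  by rewrite sum_spanning_sets; congr (_ * _); rewrite /c; lia.
rewrite (big_setID spanning_sets) /= (setIidPr spanV) span.
rewrite -(cardsID spanning_sets V) (setIidPr spanV) card_spanning_sets.
have balance a r t d b : a * r <= t + d -> d < b -> a * (b + r) < a.+1 * b + t by lia.
exact: balance rest deficit.
Qed.

End Baton.

(** * Comparison with the baton *)

Local Open Scope ring_scope.

Lemma lt_mean_subtree_order (G : sgraph) (c : nat) : (0 < #|G|)%N ->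
  (c%:R < mean_subtree_order G)
    = (c * #|subtrees G| < \sum_(H in subtrees G) #|H.1|)%N.
Proof.
case/card_gt0P=> v _; rewrite /mean_subtree_order ltr_pdivlMr.
  by rewrite -natrM ltr_nat.
by rewrite ltr0n; apply/card_gt0P; exists ([set v], set0); apply: single_vertex_subtree.
Qed.

Lemma ceil_2log2P (R : realType) (n : nat) : (0 < n)%N ->
  exists2 s : nat, Num.ceil (2 * log2 (n%:R : R)) = s%:Z & (n ^ 2 <= 2 ^ s)%N.
Proof.
move=> n0; have ln2 : 0 < ln (2 : R) by rewrite ln_gt0 // ltr1n.
have nR : 0 < (n%:R : R) by rewrite ltr0n.
have log_ge0 : 0 <= 2 * log2 (n%:R : R).
  by rewrite mulr_ge0 // divr_ge0 ?ln_ge0 ?ler1n // ltW.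
exists `|Num.ceil (2 * log2 (n%:R : R))|%N.
  by rewrite gez0_abs // ceil_ge0 (lt_le_trans _ log_ge0) // ltrN10.
set s := `|_|%N.
have : 2 * log2 (n%:R : R) <= s%:R.
  by apply: le_trans (ceil_ge _) _; rewrite /s natr_absz ler_int ler_norm.
rewrite /log2 mulrA ler_pdivrMr // mulr_natl -lnXn // mulr_natl -lnXn ?ltr0n //.
by rewrite ler_ln ?posrE ?exprn_gt0 ?ltr0n // -!natrX ler_nat.
Qed.

Theorem corollary4p4 (R : realType) (n l : nat) (T : sgraph)
  (hT : is_tree T) (hn : #|T| = n) (hl : #|leaves T| = l)
  (hopt : optimal_in (trees_of_order n) T \/
          optimal_in (caterpillars_of_order n) T) :
  l%:Z < 2 * Num.ceil (2 * log2 (n%:R : R)) + 2.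
Proof.
have n_gt0 : (0 < n)%N by rewrite -hn; case: hT.
have [s -> n2] := ceil_2log2P R n_gt0.
suff : (l < 2 * s + 2)%N by lia.
have [n_small|n_big] := leqP n (2 * s + 1).
  by have := max_card (leaves T); rewrite hl hn; lia.
have s_gt0 : (0 < s)%N by case: s n2 n_big => // + ; rewrite -mulnn; nia.
have [k nE k_gt1] : exists2 k, n = (k + s + s)%N & (1 < k)%N.
  by exists (n - s - s)%N; lia.
pose B := baton k s.
have B_order : #|B| = n by rewrite card_ord.
have BT : mean_subtree_order B <= mean_subtree_order T.
  case: hopt => -[_ best]; apply: best; split=> //.
    exact: baton_tree.
  exact: baton_caterpillar.
have T_mean : ((k + s - 1) * #|subtrees T| < \sum_(H in subtrees T) #|H.1|)%N.
  rewrite -lt_mean_subtree_order ?hn //; apply: lt_le_trans BT.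
  by rewrite lt_mean_subtree_order ?B_order // mean_baton_gt // -nE.
have T_order : (2 < #|T|)%N by lia.
have := sum_order_subtrees_leaves T_order; rewrite hl hn nE.
move: T_mean; move: (\sum_(H in _) _)%N #|subtrees T| => t N.
case: N => [|N]; first by rewrite !muln0; nia.
nia.
Qed.
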